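(* Let $n$ be a positive even integer and let $d_1 \geq d_2 \geq \dots \geq d_n \geq 1$ be integers. Let $M^- = \{(1,n),(2,n-1),\ldots,(n/2,n/2+1)\}$ and $M^+ = \{(1,2),(3,4),\ldots,(n-1,n)\}$. (a) The sequence $(d_1,\ldots,d_n)$ can realize a perfect matching if and only if it can realize $M^-$. (b) The sequence $(d_1,\ldots,d_n)$ can realize every $M \in \mathcal{M}_n$ if and only if it can realize $M^+$.
   Context: All graphs are simple. For a graph $G$ with $V(G)=[n]=\{1,\ldots,n\}$, we say $G$ realizes $(d_1,\ldots,d_n)$ if $\deg_G(i)=d_i$ for all $i\in[n]$. The sequence $(d_1,\ldots,d_n)$ can realize a perfect matching if some graph realizing it contains a perfect matching. $(i,j)$ denotes the edge between vertices $i$ and $j$. $\mathcal{M}_n$ denotes the set of all perfect matchings of the complete graph $K_n$ on vertex set $[n]$. For $M\in\mathcal{M}_n$, the sequence can realize $M$ if there is a graph $G$ on $[n]$ with $\deg_G(i)=d_i$ for all $i$ and $M\subseteq E(G)$. *)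

(* Defs.v *)
From mathcomp Require Import all_boot.
Set Implicit Arguments.
Unset Strict Implicit.
Unset Printing Implicit Defensive.

(* A graph on n vertices is given by its set of edges, an edge being a set of
   vertices.  The vertices are the elements of 'I_n: the vertex usually numbered
   k in {1, ..., n} is the ordinal of value k - 1, and d i is d_(i+1). *)

Definition simple_graph (n : nat) (E : {set {set 'I_n}}) : bool :=
  [forall e in E, #|e| == 2].

Definition degree (n : nat) (E : {set {set 'I_n}}) (i : 'I_n) : nat :=
  #|[set e in E | i \in e]|.

Definition realizes (n : nat) (E : {set {set 'I_n}}) (d : 'I_n -> nat) : Prop :=
  simple_graph E /\ forall i, degree E i = d i.

Definition perfect_matchings (n : nat) : {set {set {set 'I_n}}} :=
  [set M | simple_graph M & partition M [set: 'I_n]].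

Definition can_realize (n : nat) (d : 'I_n -> nat) (M : {set {set 'I_n}}) : Prop :=
  exists2 E : {set {set 'I_n}}, realizes E d & M \subset E.

Definition can_realize_perfect_matching (n : nat) (d : 'I_n -> nat) : Prop :=
  exists2 E : {set {set 'I_n}}, realizes E d &
    exists2 M, M \in perfect_matchings n & M \subset E.

(* rev_ord i has value n - 1 - i, i.e. it exchanges the vertices numbered k and
   n + 1 - k in {1, ..., n}. *)
Definition M_minus (n : nat) : {set {set 'I_n}} :=
  [set [set i; rev_ord i] | i : 'I_n & (i < n./2)].

(* An even ordinal i is a vertex of odd number i + 1 in {1, ..., n}. *)
Definition M_plus (n : nat) : {set {set 'I_n}} :=
  [set [set i; j] | i in 'I_n, j in 'I_n & ~~ odd i && (j == i.+1 :> nat)].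

(* Main.v *)
Require Import Defs.
From mathcomp Require Import all_boot.
From mathcomp Require Import all_fingroup.
From mathcomp Require Import zify.

Set Implicit Arguments.
Unset Strict Implicit.
Unset Printing Implicit Defensive.

(** The heart is a local exchange: if a graph with degrees d contains the
matching edges wx and yz, and d x >= d y, d w >= d z, then a single 2-switch
yields a graph with the same degrees in which these two matching edges are
replaced by wy and xz, the rest of the matching being kept.  Scanning the
vertices in order, such exchanges turn any perfect matching into M^-; read
backwards, the same scan turns M^+ into any perfect matching.  Matchings are
handled as fixpoint-free involutions, graphs as symmetric irreflexive
relations. *)

(** * Edge switches *)

Section Switch.
Variable T : finType.
Implicit Types (e : rel T) (d : T -> nat) (p q : T -> T).

Definition pairb (u v i j : T) :=
  ((i == u) && (j == v)) || ((i == v) && (j == u)).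

(** Toggles the four sides of the cycle [a b f c]. When [ab], [cf] are edges and [ac], [bf] are not,
    this is the usual 2-switch. *)
Definition switch e a b c f : rel T := fun i j =>
  e i j (+) [|| pairb a b i j, pairb c f i j, pairb a c i j | pairb b f i j].

Lemma pairbC u v i j : pairb u v i j = pairb u v j i.
Proof. by rewrite /pairb orbC ![(j == _) && _]andbC. Qed.

Lemma switch_sym e a b c f : symmetric e -> symmetric (switch e a b c f).
Proof. by move=> es i j; rewrite /switch es !(pairbC _ _ i j). Qed.

Lemma switch_irr e a b c f : irreflexive e ->
  [&& a != b, c != f, a != c & b != f] -> irreflexive (switch e a b c f).
Proof.
have P u v i : u != v -> pairb u v i i = false.
  by move=> uv; rewrite /pairb; case: (eqVneq i u) => [->|] //=; rewrite ?(negPf uv) ?andbF.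
by move=> ei /and4P[ab cf ac bf] i; rewrite /switch ei !P.
Qed.

(* The neighbourhood of a vertex of the switched cycle is transported by the
   transposition of its two neighbours on that cycle. *)
Lemma switch_degree e a b c f i : symmetric e -> irreflexive e ->
  e a b -> e c f -> ~~ e a c -> ~~ e b f -> a != c -> b != f ->
  #|[set j | switch e a b c f i j]| = #|[set j | e i j]|.
Proof.
move=> es ei eab ecf /negPf eac /negPf ebf ac bf.
have ab : a != b by apply: contraTneq eab => ->; rewrite ei.
have cf : c != f by apply: contraTneq ecf => ->; rewrite ei.
have af : a != f by apply: contraTneq ecf => <-; rewrite es eac.
have bc : b != c by apply: contraTneq eab => ->; rewrite eac.
have E (P Q : pred T) u v : (forall j, P j = Q (tperm u v j)) ->
    #|[set j | P j]| = #|[set j | Q j]|.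
  move=> PQ; rewrite -(card_preimset [set j | Q j] (@perm_inj _ (tperm u v))).
  by apply: eq_card => j; rewrite !inE PQ.
have eca : e c a = false by rewrite es.
have efb : e f b = false by rewrite es.
have eba : e b a by rewrite es.
have efc : e f c by rewrite es.
have N := (eqxx, negPf ab, negPf cf, negPf af, negPf bc, negPf ac, negPf bf).
have N' : ((b == a) = false) * ((f == c) = false) * ((f == a) = false) *
          ((c == b) = false) * ((c == a) = false) * ((f == b) = false).
  by repeat split; rewrite eq_sym N.
have [->|ia] := eqVneq i a.
  apply: (E _ _ b c) => j; rewrite /switch /pairb !(N, N') /=.
  by case: tpermP => [->|->|/eqP/negPf-> /eqP/negPf->]; rewrite ?(N, N', eab, eac) /= ?andbF ?addbF.
have [->|ib] := eqVneq i b.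
  apply: (E _ _ a f) => j; rewrite /switch /pairb !(N, N') /=.
  by case: tpermP => [->|->|/eqP/negPf-> /eqP/negPf->]; rewrite ?(N, N', eba, ebf) /= ?andbF ?addbF.
have [->|ic] := eqVneq i c.
  apply: (E _ _ a f) => j; rewrite /switch /pairb !(N, N') /=.
  by case: tpermP => [->|->|/eqP/negPf-> /eqP/negPf->]; rewrite ?(N, N', ecf, eca) /= ?andbF ?addbF.
have [->|jf] := eqVneq i f.
  apply: (E _ _ b c) => j; rewrite /switch /pairb !(N, N') /=.
  by case: tpermP => [->|->|/eqP/negPf-> /eqP/negPf->]; rewrite ?(N, N', efc, efb) /= ?andbF ?addbF.
apply: eq_card => j; rewrite !inE /switch /pairb.
by rewrite (negPf ia) (negPf ib) (negPf ic) (negPf jf) addbF.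
Qed.

(** Without such a [v], the transposition of [x] and [y] would map the neighbours of [x] into the
    neighbours of [y] other than [z], against the degree inequality. *)
Lemma private_neighbour e x y z : symmetric e -> irreflexive e ->
  #|[set j | e y j]| <= #|[set j | e x j]| -> e y z -> ~~ e x z -> z != x ->
  exists v, [/\ v != y, e x v & ~~ e y v].
Proof.
move=> es ei le eyz exz zx.
have [/existsP[v /and3P[? ? ?]]|no] := boolP [exists v, [&& v != y, e x v & ~~ e y v]].
  by exists v.
have no' v : e x v -> v = y \/ e y v.
  move: no; rewrite negb_exists => /forallP/(_ v).
  by case: eqVneq => [->|_] /=; [left | move=> h exv; move: h; rewrite exv negbK; right].
move: le; rewrite leqNgt => /negP[]; rewrite [leqRHS](cardsD1 z) inE eyz ltnS.
rewrite -(card_imset _ (@perm_inj _ (tperm x y))).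
apply/subset_leq_card/subsetP => _ /imsetP[j jx ->]; move: jx; rewrite !inE => jx.
case: tpermP => [jE|jE|jnx jny]; first by rewrite jE ei in jx.
  by rewrite eq_sym zx es -jE.
case: (no' _ jx) => // ->; rewrite andbT.
by apply: contraNneq exz => <-.
Qed.

Definition involution_no_fixpoint p := involutive p /\ forall i, p i != i.

Definition realizable d p := exists e, [/\ symmetric e, irreflexive e,
  forall i, #|[set j | e i j]| = d i & forall i, e i (p i)].

Lemma eq_realizable d p q : p =1 q -> realizable d p -> realizable d q.
Proof. by move=> pq [e [es ei ed ep]]; exists e; split=> // i; rewrite -pq. Qed.

(* If p pairs x with w and y with z, then [exchange x y p] pairs y with w and
   x with z. *)
Definition exchange x y p := fun i => tperm x y (p (tperm x y i)).

Lemma exchange_involution x y p :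
  involution_no_fixpoint p -> involution_no_fixpoint (exchange x y p).
Proof.
case=> pK pN; split=> i; rewrite /exchange; first by rewrite tpermK pK tpermK.
by rewrite -{2}(tpermK x y i) (inj_eq perm_inj) pN.
Qed.

Lemma exchangeK x y p : exchange x y (exchange x y p) =1 p.
Proof. by move=> i; rewrite /exchange !tpermK. Qed.

(* One switch suffices: if exactly one of wy and xz is an edge, a vertex v
   given by [private_neighbour] plays the role of the missing fourth vertex. *)
Lemma realizable_exchange d p w y : involution_no_fixpoint p ->
  w != y -> p w != y -> d y <= d (p w) -> d (p y) <= d w ->
  realizable d p -> realizable d (exchange (p w) y p).
Proof.
move=> [pK pN] wy xy dyx dzw [e [es ei ed ep]].
set x := p w in xy dyx *; set z := p y in dzw *.
have px : p x = w by rewrite /x pK.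
have pz : p z = y by rewrite /z pK.
have wx : w != x by rewrite eq_sym pN.
have yz : y != z by rewrite eq_sym pN.
have wz : w != z by apply: contraNneq xy => wz; rewrite /x wz pz.
have xz : x != z by apply: contraNneq wy => xz; rewrite -px xz pz.
have exw : e w x by apply: ep.
have eyz : e y z by apply: ep.
have tw : tperm x y w = w by rewrite tpermD 1?eq_sym.
have tz : tperm x y z = z by rewrite tpermD.
have q_w : exchange x y p w = y by rewrite /exchange tw -/x tpermL.
have q_x : exchange x y p x = z by rewrite /exchange tpermL -/z.
have q_y : exchange x y p y = w by rewrite /exchange tpermR px.
have q_z : exchange x y p z = x by rewrite /exchange tz pz tpermR.
have q_o i : i \notin [:: w; x; y; z] ->
    exchange x y p i = p i /\ p i \notin [:: w; x; y; z].
  rewrite !inE !negb_or => /and4P[iw ix iy iz].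
  have E u : (p i == u) = (i == p u) by rewrite (can2_eq pK pK).
  rewrite !E px pz -/x -/z iw ix iy iz; split=> //.
  by rewrite /exchange [tperm x y i]tpermD 1?eq_sym // tpermD // eq_sym E ?px.
(* Matching edges other than [wx] and [yz] avoid all four vertices, so besides containing [wy] and
   [xz] a new graph need only keep the edges away from these vertices. *)
have main e' : symmetric e' -> irreflexive e' ->
    (forall i, #|[set j | e' i j]| = #|[set j | e i j]|) -> e' w y -> e' x z ->
    (forall i j, i \notin [:: w; x; y; z] -> j \notin [:: w; x; y; z] -> e i j -> e' i j) ->
    realizable d (exchange x y p).
  move=> es' ei' ed' ewy' exz' eo'; exists e'; split=> // i; first by rewrite ed'.
  have [|io] := boolP (i \in [:: w; x; y; z]); last first.
    by have [-> ?] := q_o _ io; apply: eo'.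
  by rewrite !inE => /or4P[]/eqP->; rewrite ?q_w ?q_x ?q_y ?q_z // es'.
have sw a b c f : e a b -> e c f -> ~~ e a c -> ~~ e b f -> a != c -> b != f ->
    switch e a b c f w y -> switch e a b c f x z ->
    (forall i j, i \notin [:: w; x; y; z] -> j \notin [:: w; x; y; z] ->
      e i j -> switch e a b c f i j) -> realizable d (exchange x y p).
  move=> eab ecf eac ebf ac bf; apply: main; first exact: switch_sym.
    apply: switch_irr => //; rewrite ac bf !andbT.
    by apply/andP; split; [apply: contraTneq eab => -> | apply: contraTneq ecf => ->];
      rewrite ei.
  by move=> i; apply: switch_degree.
have far i : i \notin [:: w; x; y; z] -> [/\ i != w, i != x, i != y & i != z].
  by rewrite !inE !negb_or => /and4P.
have [ewy|ewy] := boolP (e w y); have [exz|exz] := boolP (e x z).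
- exact: main.
(* Only [xz] is missing: trade [xv] and [zy] for [xz] and [vy]. Here [v] is not [w], because [wy] is
   an edge and [vy] is not. *)
- have [||v [vy exv eyv]] := private_neighbour es ei _ eyz exz; rewrite ?ed 1?eq_sym //.
  have vw : w != v by apply: contraNneq eyv => <-; rewrite es.
  apply: (sw x v z y) => //; rewrite 1?es //.
  + by rewrite /switch /pairb ewy (negPf wx) (negPf vw) (negPf wz) (negPf wy).
  + by rewrite /switch /pairb (negPf exz) !eqxx /= !orbT.
  + move=> i j /far[_ ix iy iz] /far[_ jx jy jz] eij.
    by rewrite /switch /pairb eij (negPf ix) (negPf iy) (negPf iz) (negPf jx) (negPf jy) !andbF.
(* Only [wy] is missing: [w] now has a neighbour [v] that [z] lacks, and [wv], [yz] are traded for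
   [wy], [vz]. *)
- have ezx : e z x by rewrite es.
  have ezy : e z y by rewrite es.
  have [||v [vz ewv ezv]] := private_neighbour es ei _ ezy ewy; rewrite ?ed 1?eq_sym //.
  have vx : x != v by apply: contraNneq ezv => <-.
  apply: (sw w v y z) => //; rewrite 1?es //.
  + by rewrite /switch /pairb (negPf ewy) !eqxx /= !orbT.
  + by rewrite /switch /pairb exz !(eq_sym x w) (negPf wx) (negPf vx) (negPf xz) (negPf xy).
  + move=> i j /far[iw _ iy iz] /far[jw _ jy jz] eij.
    by rewrite /switch /pairb eij (negPf iw) (negPf iy) (negPf iz) (negPf jw) (negPf jy) (negPf jz) !andbF.
(* Both are missing: the switch acts on the two matching edges themselves. *)
- apply: (sw w x y z) => //.
  + by rewrite /switch /pairb (negPf ewy) !eqxx /= !orbT.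
  + by rewrite /switch /pairb (negPf exz) !eqxx /= !orbT.
  + move=> i j /far[iw ix iy iz] _ eij.
    by rewrite /switch /pairb eij (negPf iw) (negPf iy) (negPf iz) (negPf ix).
Qed.

End Switch.

(** * Comparing a matching with a target matching *)

Section Agreement.
Variable n : nat.
Implicit Types p q : 'I_n -> 'I_n.

Definition agree_below p q k := forall i : 'I_n, i < k -> p i = q i.

(** A vertex below [k] has the same partner under both involutions; if one of these four vertices
    were below [k], applying the involutions again would force [p k = q k]. *)
Lemma agree_below_gt p q (k : 'I_n) : involutive p -> involutive q ->
  agree_below p q k -> p k <> q k ->
  [/\ k <= p k, k <= q k, k <= p (q k) & k <= q (p k)].
Proof.
move=> pK qK ag ne; split; rewrite leqNgt; apply/negP => /ag.
- by rewrite pK => h; apply: ne; rewrite {2}h qK.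
- by rewrite qK => h; apply: ne; rewrite -{1}h pK.
- by rewrite pK => /(congr1 q); rewrite !qK => h; apply: ne; rewrite {1}h pK.
- by rewrite qK => /(congr1 p); rewrite !pK => h; apply: ne; rewrite -{2}h qK.
Qed.

(** The exchange pairs [k] with [q k]. A vertex below [k] and its partner both differ from [p k] and
    [q k], so their pairing is untouched. *)
Lemma agree_below_exchange p q (k : 'I_n) :
  involution_no_fixpoint p -> involution_no_fixpoint q ->
  agree_below p q k -> p k <> q k ->
  agree_below (exchange (p k) (q k) p) q k.+1.
Proof.
move=> [pK pN] [qK qN] ag ne i.
have [kp kq _ _] := agree_below_gt pK qK ag ne.
rewrite ltnS leq_eqVlt => /orP[/eqP/val_inj->|ik]; rewrite /exchange.
  by rewrite [tperm _ _ k]tpermD ?tpermL ?pN ?qN.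
rewrite [tperm _ _ i]tpermD; first last.
- by rewrite neq_ltn orbC (leq_trans ik kq).
- by rewrite neq_ltn orbC (leq_trans ik kp).
have ki : k != i by rewrite neq_ltn ik orbT.
rewrite (ag i ik) tpermD //; last by rewrite (inj_eq (inv_inj qK)).
by rewrite -(ag i ik) (inj_eq (inv_inj pK)).
Qed.

(** States the scan once for both directions: [P p] is an implication from realizability of [p] when
    moving towards [q], and realizability of [p] itself when moving back from [q]. *)
Lemma exchange_ind q (P : ('I_n -> 'I_n) -> Prop) : involution_no_fixpoint q ->
  (forall p, p =1 q -> P p) ->
  (forall p (k : 'I_n), involution_no_fixpoint p -> agree_below p q k -> p k <> q k ->
     P (exchange (p k) (q k) p) -> P p) ->
  forall p, involution_no_fixpoint p -> P p.
Proof.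
move=> qi Peq Pex p pi.
(* [m] counts the vertices still to be scanned, starting from [k]. *)
suff H m k : k + m = n -> agree_below p q k -> P p by apply: (H n 0).
elim: m p pi k => [|m IH] p pi k km ag.
  by apply: Peq => i; apply: ag; rewrite -[k]addn0 km.
have kn : k < n by lia.
have mk : k.+1 + m = n by lia.
case: (eqVneq (p (Ordinal kn)) (q (Ordinal kn))) => [E|/eqP ne].
  apply: IH mk _ => // i; rewrite ltnS leq_eqVlt => /orP[/eqP ik|/ag//].
  by rewrite (_ : i = Ordinal kn) //; apply: val_inj.
apply: (Pex p (Ordinal kn)) => //; apply: IH mk _; first exact: exchange_involution.
exact: (@agree_below_exchange p q (Ordinal kn)).
Qed.

End Agreement.

(** * Scans under a nonincreasing degree sequence *)

Section Monotone.
Variables (n : nat) (d : 'I_n -> nat).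
Hypothesis d_noninc : forall i j : 'I_n, i <= j -> d j <= d i.

(** At the first disagreement [k], reflecting [k <= rev_ord (p k)] gives [p k <= rev_ord k].
    Together with [k <= p (rev_ord k)], this yields both degree inequalities of the exchange. *)
Lemma realizable_rev_ord p : involution_no_fixpoint (@rev_ord n) ->
  involution_no_fixpoint p -> realizable d p -> realizable d (@rev_ord n).
Proof.
move=> qi pi; move: p pi.
apply: (exchange_ind (P := fun p => realizable d p -> _) qi) => [p|p k pi ag ne IH rp].
  exact: eq_realizable.
apply: IH; have [_ _ kz kx] := agree_below_gt pi.1 qi.1 ag ne.
apply: realizable_exchange => //; [by rewrite eq_sym qi.2 | exact/eqP | | exact: d_noninc].
apply: d_noninc; move: kx (ltn_ord k) (ltn_ord (p k)) => /=; lia.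
Qed.

(** Here the exchange is undone, so [q k] must have degree at least that of [p k]: this follows from
    [q k <= k.+1 <= p k]. *)
Lemma realizable_from_adjacent (q p : 'I_n -> 'I_n) : involution_no_fixpoint q ->
  (forall k : 'I_n, q k <= k.+1) ->
  involution_no_fixpoint p -> realizable d q -> realizable d p.
Proof.
move=> qi q_le pi rq; move: p pi.
apply: (exchange_ind (P := realizable d) qi) => [p pq|p k pi ag ne IH].
  by apply: eq_realizable rq => i; rewrite pq.
have [kp kq kz _] := agree_below_gt pi.1 qi.1 ag ne.
have ki := exchange_involution (p k) (q k) pi.
have pN := pi.2.
have Ek : exchange (p k) (q k) p k = q k.
  by rewrite /exchange [tperm _ _ k]tpermD ?tpermL // qi.2.
have Ep : exchange (p k) (q k) p (p k) = p (q k).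
  rewrite /exchange tpermL tpermD //; last by rewrite eq_sym.
  by rewrite (inj_eq (inv_inj pi.1)) eq_sym qi.2.
have kpk : k < p k by rewrite ltn_neqAle kp andbT eq_sym; apply: pN.
(* In the exchanged matching [k] is paired with [q k], and [p k] with [p (q k)]; exchanging the same
   two vertices again restores [p]. *)
have := realizable_exchange (d := d) (w := k) (y := p k) ki.
rewrite Ek Ep => H; apply: (eq_realizable (@exchangeK _ (p k) (q k) p)).
apply: (eq_realizable _ (H _ _ _ _ IH)).
- by move=> i; rewrite {1}/exchange tpermC.
- by rewrite eq_sym.
- by apply/eqP => /esym.
- by apply: d_noninc; apply: leq_trans (q_le k) _.
- exact: d_noninc.
Qed.

End Monotone.

(** * Edge sets *)

Section Bridge.
Variable n : nat.
Implicit Types (d : 'I_n -> nat) (p : 'I_n -> 'I_n) (M E : {set {set 'I_n}}).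

Definition edges_of p : {set {set 'I_n}} := [set [set i; p i] | i : 'I_n].

Lemma can_realize_edges_of d p : involution_no_fixpoint p ->
  can_realize d (edges_of p) <-> realizable d p.
Proof.
move=> [pK pN]; split.
  case=> E [sE dE] /subsetP ME.
  exists (fun i j => (i != j) && ([set i; j] \in E)); split.
  - by move=> i j; rewrite eq_sym setUC.
  - by move=> i; rewrite eqxx.
  - move=> i; rewrite -dE /degree.
    (* Neighbours [j] of [i] correspond bijectively to the edges [[set i; j]] through [i]. *)
    rewrite -(card_in_imset (f := fun j => [set i; j]) (D := [set j | _])).
      apply: eq_card => s; rewrite !inE; apply/imsetP/andP => [[j]|[sin is_]].
        by rewrite inE => /andP[_ jE] ->; rewrite jE !inE eqxx.
      have /cards2P[a [b [ab sab]]] : #|s| == 2 by apply: (forall_inP sE).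
      move: is_; rewrite sab !inE => /orP[]/eqP->.
        by exists b => //; rewrite inE ab -sab.
      by exists a; rewrite 1?setUC // inE eq_sym ab setUC -sab.
    move=> j k; rewrite !inE => /andP[ij _] /andP[ik _] /setP/(_ j).
    by rewrite !inE eqxx orbT eq_sym (negPf ij) => /esym/eqP.
  - by move=> i; rewrite eq_sym pN ME //; apply: imset_f.
case=> e [es ei ed ep].
(* Quantifying over all pairs in [s] avoids choosing an order of the two endpoints. *)
pose E := [set s : {set 'I_n} | (#|s| == 2) &&
  [forall i in s, forall j in s, (i != j) ==> e i j]].
have inE' i j : i != j -> ([set i; j] \in E) = e i j.
  move=> ij; rewrite inE cards2 ij /=; apply/forall_inP/idP => [h|eij k].
    have /h/forall_inP/(_ j) : i \in [set i; j] by rewrite !inE eqxx.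
    by rewrite !inE eqxx orbT ij => /(_ isT).
  rewrite !inE => kij; apply/forall_inP => l; rewrite !inE => lij.
  apply/implyP; case/orP: kij => /eqP->; case/orP: lij => /eqP-> //; rewrite ?eqxx //.
  by rewrite es.
have eN i j : e i j -> i != j by apply: contraTneq => ->; rewrite ei.
exists E; last first.
  by apply/subsetP => _ /imsetP[i _ ->]; rewrite inE' // eq_sym.
split; first by apply/forall_inP => s; rewrite inE => /andP[].
move=> i; rewrite -ed /degree.
rewrite -(card_in_imset (f := fun j => [set i; j]) (D := [set j | _])); last first.
  move=> j k; rewrite !inE => /eN ij /eN ik /setP/(_ j).
  by rewrite !inE eqxx orbT eq_sym (negPf ij) => /esym/eqP.
apply: eq_card => s; rewrite in_set; apply/andP/imsetP => [[sin is_]|[j]]; last first.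
  by rewrite inE => eij ->; rewrite inE' ?eN // eij !inE eqxx.
have /cards2P[a [b [ab sab]]] : #|s| == 2 by move: sin; rewrite inE => /andP[].
move: sin is_; rewrite sab inE' // !inE => eab /orP[]/eqP->.
  by exists b; rewrite ?inE.
by exists a; rewrite 1?setUC // inE es.
Qed.

Lemma edges_of_perfect_matching p : involution_no_fixpoint p ->
  edges_of p \in perfect_matchings n.
Proof.
move=> [pK pN]; rewrite inE; apply/andP; split.
  by apply/forall_inP => _ /imsetP[i _ ->]; rewrite cards2 (eq_sym i) pN.
apply/and3P; split.
- rewrite eqEsubset subsetT; apply/subsetP => i _; apply/bigcupP.
  by exists [set i; p i]; [apply: imset_f | rewrite !inE eqxx].
- apply/trivIsetP => _ _ /imsetP[i _ ->] /imsetP[j _ ->].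
  apply: contraR => /pred0Pn[k] /=; rewrite !inE => /andP[ki kj]; apply/eqP.
  have H m : (k == m) || (k == p m) -> [set m; p m] = [set k; p k].
    by case/orP=> /eqP->; rewrite // pK setUC.
  by rewrite (H i ki) (H j kj).
- by apply/imsetP => -[i _ /setP/(_ i)]; rewrite !inE eqxx.
Qed.

(** [p] sends a vertex to the other element of its block; disjointness of the blocks makes the block
    unique, hence [p] involutive. *)
Lemma perfect_matchingP M : M \in perfect_matchings n ->
  exists2 p, involution_no_fixpoint p & M = edges_of p.
Proof.
rewrite inE => /andP[/forall_inP M2 /and3P[/eqP cM tM _]].
have ex i : exists j, (j != i) && ([set i; j] \in M).
  have : i \in cover M by rewrite cM inE.
  case/bigcupP=> s sM; have /cards2P[a [b [ab sab]]] := M2 _ sM.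
  rewrite sab in sM *; rewrite !inE => /orP[]/eqP->.
    by exists b; rewrite eq_sym ab.
  by exists a; rewrite ab setUC.
pose p i := xchoose (ex i).
have pN i : p i != i by case/andP: (xchooseP (ex i)).
have pM i : [set i; p i] \in M by case/andP: (xchooseP (ex i)).
have block_of i (s : {set 'I_n}) : i \in s -> s \in M -> s = [set i; p i].
  move=> is_ sM; apply: contraTeq (is_) => ne.
  rewrite (disjointFr (A := [set i; p i])) //; last by rewrite !inE eqxx.
  by apply: (trivIsetP tM) => //; rewrite eq_sym.
have pK : involutive p.
  move=> i; have := block_of (p i) [set i; p i]; rewrite !inE eqxx orbT pM.
  move=> /(_ isT isT)/setP/(_ i); rewrite !inE eqxx /= => /esym.
  by rewrite [i == p i]eq_sym (negPf (pN i)) => /eqP.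
exists p => //; apply/setP => s; apply/idP/imsetP => [sM|[i _ ->]//].
have /cards2P[a [b [ab sab]]] := M2 _ sM.
by exists a => //; apply: block_of => //; rewrite sab !inE eqxx.
Qed.

(** Parity is that of the zero-based value. The default [i] of [insubd] would be reached only for an
    even [i] with [i.+1 = n], which an even [n] excludes. *)
Definition adjacent (i : 'I_n) : 'I_n :=
  insubd i (if odd i then i.-1 else i.+1).

Hypothesis n_even : ~~ odd n.

Lemma adjacentE (i : 'I_n) : adjacent i = (if odd i then i.-1 else i.+1) :> nat.
Proof.
rewrite /adjacent val_insubd; have := ltn_ord i.
by case: ifP => //; case: ifP => oi; lia.
Qed.

Lemma adjacent_involution : involution_no_fixpoint adjacent.
Proof.
split=> i; last first.
  by apply/eqP => /(congr1 val) /=; rewrite adjacentE; case: ifP; lia.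
apply: val_inj; rewrite /= !adjacentE.
by case: (boolP (odd i)) => oi; case: ifP; lia.
Qed.

Lemma rev_ord_involution : involution_no_fixpoint (@rev_ord n).
Proof.
split=> i; first exact: rev_ordK.
by apply/eqP => /(congr1 val) /=; have := ltn_ord i; lia.
Qed.

Lemma M_plusE : M_plus n = edges_of adjacent.
Proof.
apply/setP => s; apply/imset2P/imsetP => [[i j _]|[i _ ->]].
  rewrite inE => /andP[_ /andP[oi /eqP ji]] ->; exists i => //; congr [set _; _].
  by apply: val_inj; rewrite /= adjacentE (negPf oi).
have := adjacentE i; case: (boolP (odd i)) => oi E.
  exists (adjacent i) i => //; last by rewrite setUC.
  by rewrite !inE E; apply/andP; split; lia.
by exists i (adjacent i) => //; rewrite !inE E oi eqxx.
Qed.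

Lemma M_minusE : M_minus n = edges_of (@rev_ord n).
Proof.
apply/setP => s; apply/imsetP/imsetP => [[i _ ->]|[i _ ->]]; first by exists i.
case: (ltnP i n./2) => h; first by exists i; rewrite ?inE.
(* [edges_of] lists each edge from both ends, [M_minus] only from its lower end, so an upper index
   is replaced by its mirror image. *)
exists (rev_ord i); last by rewrite rev_ordK setUC.
by rewrite inE /=; have := ltn_ord i; lia.
Qed.

End Bridge.

Theorem theorem3 (n : nat) (d : 'I_n -> nat)
    (n_gt0 : 0 < n) (n_even : ~~ odd n)
    (d_noninc : forall i j : 'I_n, i <= j -> d j <= d i)
    (d_ge1 : forall i : 'I_n, 1 <= d i) :
  (can_realize_perfect_matching d <-> can_realize d (M_minus n)) /\
  ((forall M : {set {set 'I_n}}, M \in perfect_matchings n -> can_realize d M)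
     <-> can_realize d (M_plus n)).
Proof.
have ri := rev_ord_involution n_even; have ai := adjacent_involution n_even.
rewrite M_plusE // M_minusE //; split; split.
- case=> E rE [M /perfect_matchingP[p pi ->] ME].
  apply/(can_realize_edges_of d ri)/(realizable_rev_ord d_noninc ri pi).
  by apply/(can_realize_edges_of d pi); exists E.
- by case=> E rE ME; exists E => //; exists (edges_of (@rev_ord n)) => //;
    apply: edges_of_perfect_matching.
- by apply; apply: edges_of_perfect_matching.
- move=> /(can_realize_edges_of d ai) ra M /perfect_matchingP[p pi ->].
  apply/(can_realize_edges_of d pi); apply: (realizable_from_adjacent d_noninc ai) ra => // k.
  by rewrite adjacentE //; case: ifP; lia.
Qed.
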